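(* Let $\Gamma=(\gamma_{ij})$ be a skew-symmetric $n\times n$ matrix with entries in $\mathbf{k}$, that is, $\gamma_{ij}=-\gamma_{ji}$ for all $i,j=1,\dots,n$. Let $P=(p_1,\dots,p_n)$ and $Q=(q_1,\dots,q_n)$ be elements of $\mathbf{k}^n$ such that $p_i\neq q_i$ for each $i=1,\dots,n$. Then the polynomial ring $\mathbf{k}[y_1,x_1,\dots,y_n,x_n]$ has a Poisson bracket satisfying $$\begin{array}{ll} \{y_i,y_j\}=\gamma_{ij}y_iy_j &(\text{all } i,j)\\ \{x_i,y_j\}=(p_j-\gamma_{ij})y_jx_i &(i<j)\\ \{y_i,x_j\}=-(q_i+\gamma_{ij})y_ix_j &(i<j)\\ \{x_i,x_j\}=(q_i-p_j+\gamma_{ij})x_ix_j &(i<j)\\ \{x_i,y_i\}=q_iy_ix_i+\sum_{k=1}^{i-1}(q_k-p_k)y_kx_k &(\text{all } i). \end{array}$$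
   Context: $\mathbf{k}$ is an algebraically closed field of characteristic zero. A Poisson bracket on a commutative $\mathbf{k}$-algebra $A$ is a $\mathbf{k}$-bilinear map $\{\cdot,\cdot\}:A\times A\to A$ such that $(A,\{\cdot,\cdot\})$ is a Lie algebra and $\{ab,c\}=a\{b,c\}+b\{a,c\}$ for all $a,b,c\in A$. *)

(* Defs.v *)
From HB Require Import structures.
From mathcomp Require Import all_boot all_order all_algebra.
From mathcomp Require Import mpoly.

Set Implicit Arguments.
Unset Strict Implicit.
Unset Printing Implicit Defensive.

Import GRing.Theory.
Local Open Scope ring_scope.

Record is_lie_bracket (k : fieldType) (L : lmodType k) (br : L -> L -> L)
    : Prop := IsLieBracket {
  lie_linearl : forall b, linear (fun a => br a b);
  lie_linearr : forall a, linear (br a);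
  lie_alternating : forall a, br a a = 0;
  lie_jacobi : forall a b c,
    br a (br b c) + br b (br c a) + br c (br a b) = 0
}.

Record is_poisson_bracket (k : fieldType) (A : comAlgType k)
    (br : A -> A -> A) : Prop := IsPoissonBracket {
  poisson_lie : is_lie_bracket br;
  poisson_leibniz : forall a b c, br (a * b) c = a * br b c + b * br a c
}.

(* The polynomial ring k[y_1, x_1, ..., y_n, x_n] is {mpoly k[n + n]}: the
   first n indeterminates are the y_i, the last n are the x_i; indices run
   over 'I_n, hence start at 0. *)
Definition yvar (k : fieldType) (n : nat) (i : 'I_n) : {mpoly k[n + n]} :=
  'X_(lshift n i).

Definition xvar (k : fieldType) (n : nat) (i : 'I_n) : {mpoly k[n + n]} :=
  'X_(rshift n i).

(* Main.v *)
Require Import Defs.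
From HB Require Import structures.
From mathcomp Require Import all_boot all_order all_algebra.
From mathcomp Require Import mpoly ring.

Set Implicit Arguments.
Unset Strict Implicit.
Unset Printing Implicit Defensive.

Import GRing.Theory.
Local Open Scope ring_scope.

(* Put z_l = y_l x_l and w_i = \sum_(l < i) (q_l - p_l) z_l.  The prescribed
   values on generators extend to a unique skew biderivation, whose Jacobiator
   is a derivation in each argument, so the Jacobi identity has to be checked
   on generators only.  Generators with distinct indices have log-canonical
   brackets, and the Jacobi identity is automatic for three pairwise
   log-canonical elements.  The only other case is a triple x_i, y_i, u with
   u = x_j or u = y_j and j <> i; there it amounts to
   {q_i z_i + w_i, u} = (a + b) (q_i z_i + w_i) u, where {x_i, u} = a x_i u
   and {y_i, u} = b y_i u.  The element z_i satisfies this by the Leibniz rule;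
   for w_i the terms l <= j telescope, since {z_j, u} is itself
   +-(q_j z_j + w_j) u. *)

(** The kernel of a derivation is a subspace closed under products; it contains 1 because D 1 = D 1
    + D 1, hence every monomial once it contains the indeterminates. *)
Lemma mpoly_derivation_eq0 (k : fieldType) (m : nat)
    (D : {mpoly k[m]} -> {mpoly k[m]}) :
  (forall c p q, D (c *: p + q) = c *: D p + D q) ->
  (forall p q, D (p * q) = p * D q + q * D p) ->
  (forall a, D 'X_a = 0) -> forall p, D p = 0.
Proof.
move=> Dlin DM DX.
have D0 : D 0 = 0.
  have /eqP := Dlin 1 0 0.
  by rewrite !scale1r addr0 -subr_eq0 opprD addNKr oppr_eq0 => /eqP.
have D1 : D 1 = 0.
  have /eqP := DM 1 1.
  by rewrite !mul1r -subr_eq0 opprD addNKr oppr_eq0 => /eqP.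
have Dmul p q : D p = 0 -> D q = 0 -> D (p * q) = 0.
  by move=> Dp Dq; rewrite DM Dp Dq !mulr0 addr0.
elim/mpolyind => [//|c mm p _ _ Dp]; rewrite Dlin Dp addr0 mpolyXE_id.
rewrite (big_ind (fun p => D p = 0)) ?scaler0 // => a _.
by elim: (mm a) => [|e IHe]; rewrite ?expr0 // exprS Dmul.
Qed.

Record skew_biderivation (k : fieldType) (A : comAlgType k) (br : A -> A -> A)
    : Prop := SkewBiderivation {
  skewbd_linearl : forall b, linear (br^~ b);
  skewbd_Ml : forall a b c, br (a * b) c = a * br b c + b * br a c;
  skewbd_skew : forall a b, br a b = - br b a
}.

(** * Skew biderivations and their Jacobiators *)

Section SkewBiderivation.

Variables (k : fieldType) (m : nat).
Variable br : {mpoly k[m]} -> {mpoly k[m]} -> {mpoly k[m]}.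
Hypothesis br_bider : skew_biderivation br.
Implicit Types p q r : {mpoly k[m]}.

Let br_skew := skewbd_skew br_bider.
Let br_linearl := skewbd_linearl br_bider.
Let br_Ml := skewbd_Ml br_bider.

Lemma skewbd_linearr p : linear (br p).
Proof.
move=> c q q'; rewrite br_skew br_linearl.
by rewrite opprD -scalerN -!br_skew.
Qed.

Lemma skewbd_Mr p q r : br p (q * r) = q * br p r + r * br p q.
Proof.
by rewrite br_skew br_Ml (br_skew q) (br_skew r); ring.
Qed.

Lemma skewbd_Zl c p q : br (c *: p) q = c *: br p q.
Proof. exact: (GRing.scalable_linear (br_linearl q)). Qed.

Lemma skewbd_Dl p q r : br (p + q) r = br p r + br q r.
Proof. by have /= := br_linearl r 1 p q; rewrite !scale1r. Qed.

Lemma skewbd_Zr c p q : br p (c *: q) = c *: br p q.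
Proof. exact: (GRing.scalable_linear (@skewbd_linearr p)). Qed.

Lemma skewbd_Dr p q r : br p (q + r) = br p q + br p r.
Proof. by have := skewbd_linearr p 1 q r; rewrite !scale1r. Qed.

Lemma skewbd_Nr p q : br p (- q) = - br p q.
Proof. by rewrite -scaleN1r skewbd_Zr scaleN1r. Qed.

Lemma skewbd_0l p : br 0 p = 0.
Proof. by rewrite -(scale0r 0) skewbd_Zl !scale0r. Qed.

Lemma skewbd_0r p : br p 0 = 0.
Proof. by rewrite br_skew skewbd_0l oppr0. Qed.

Lemma skewbd_alternating : [pchar k] =i pred0 -> forall p, br p p = 0.
Proof.
move=> /pcharf0P char0 p; apply/eqP.
have /eqP : 2%:R *: br p p = 0.
  by rewrite scaler_nat mulr2n {1}br_skew addNr.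
by rewrite scaler_eq0 char0.
Qed.

Definition jacobiator p q r :=
  br p (br q r) + br q (br r p) + br r (br p q).
Local Notation jac := jacobiator.

Lemma jacobiator_cycle p q r : jac p q r = jac q r p.
Proof. by rewrite /jacobiator; ring. Qed.

Lemma jacobiator_swap p q r : jac p q r = - jac q p r.
Proof.
rewrite /jacobiator (br_skew q r) (br_skew r p) (br_skew p q).
by rewrite !skewbd_Nr; ring.
Qed.

Lemma jacobiator_diag : [pchar k] =i pred0 -> forall p q, jac p p q = 0.
Proof.
move=> char0 p q; rewrite /jacobiator skewbd_alternating // (br_skew q p).
by rewrite skewbd_Nr skewbd_0r subrr add0r.
Qed.

Lemma jacobiator_linear p q c r r' :
  jac p q (c *: r + r') = c *: jac p q r + jac p q r'.
Proof.
rewrite /jacobiator !(skewbd_Dl, skewbd_Dr, skewbd_Zl, skewbd_Zr).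
by rewrite -!mul_mpolyC; ring.
Qed.

Lemma jacobiatorM p q r r' : jac p q (r * r') = r * jac p q r' + r' * jac p q r.
Proof.
rewrite /jacobiator !(br_Ml, skewbd_Mr, skewbd_Dr).
(* Once {r, p} and {r', p} are reversed, the mixed products {q, r'}{p, r} and {q, r}{p, r'} each
   occur twice with opposite signs. *)
by rewrite (br_skew r p) (br_skew r' p) !skewbd_Nr; ring.
Qed.

(** Cyclic invariance brings each argument in turn to the last place, where the Jacobiator is a
    derivation. *)
Lemma jacobiator_eq0 :
  (forall a b c, jac 'X_a 'X_b 'X_c = 0) -> forall p q r, jac p q r = 0.
Proof.
pose eq0 p q :=
  mpoly_derivation_eq0 (@jacobiator_linear p q) (@jacobiatorM p q).
move=> jacX p q; apply: (eq0) => c; rewrite jacobiator_cycle.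
move: p; apply: (eq0) => a; rewrite jacobiator_cycle.
by move: q; apply: (eq0) => b; rewrite jacobiator_cycle.
Qed.

Lemma skewbd_poisson :
    [pchar k] =i pred0 -> (forall a b c, jac 'X_a 'X_b 'X_c = 0) ->
  is_poisson_bracket br.
Proof.
move=> char0 jacX; split; last exact: br_Ml.
split; [exact: br_linearl | exact: skewbd_linearr | |].
- exact: skewbd_alternating.
- exact: jacobiator_eq0.
Qed.

(** The three double brackets are b(a - c), c(b - a) and a(c - b) times pqr. *)
Lemma jacobiator_log_canonical a b c p q r :
    br p q = a *: (p * q) -> br q r = b *: (q * r) -> br r p = c *: (r * p) ->
  jac p q r = 0.
Proof.
move=> pq qr rp; rewrite /jacobiator pq qr rp !skewbd_Zr !skewbd_Mr.
rewrite (br_skew q p) (br_skew r q) (br_skew p r) pq qr rp.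
by rewrite -!mul_mpolyC; ring.
Qed.

(** Here {p, q} is arbitrary: the Leibniz rule gives {p, {q, r}} + {q, {r, p}} = (a + b){p, q}r,
    which the third hypothesis cancels. *)
Lemma jacobiator_semi_log_canonical a b p q r :
    br p r = a *: (p * r) -> br q r = b *: (q * r) ->
    br (br p q) r = (a + b) *: (br p q * r) ->
  jac p q r = 0.
Proof.
move=> pr qr pqr; rewrite /jacobiator (br_skew r (br p q)) pqr qr.
rewrite (br_skew r p) pr -scaleNr !skewbd_Zr !skewbd_Mr.
by rewrite pr qr (br_skew q p) -!mul_mpolyC; ring.
Qed.

End SkewBiderivation.

(** * The biderivation with prescribed values on the indeterminates *)

Section Biderivation.

Variables (k : fieldType) (m : nat).
Variable B : 'I_m -> 'I_m -> {mpoly k[m]}.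

Definition biderivation (p q : {mpoly k[m]}) :=
  \sum_a \sum_b B a b * (p^`M(a) * q^`M(b)).
Local Notation br := biderivation.

Lemma biderivationX a b : br 'X_a 'X_b = B a b.
Proof.
have dX i j : ('X_i : {mpoly k[m]})^`M(j) = (i == j)%:R.
  rewrite mderivX mnm1E; case: eqVneq => [->|_]; last by rewrite scale0r.
  by rewrite scale1r -[X in (X - _)%MM]add0m addmK mpolyX0.
rewrite /biderivation (bigD1 a) //= (bigD1 b) //= !dX !eqxx !mulr1.
rewrite big1 => [|j /negPf nj]; last by rewrite dX eq_sym nj !mulr0.
rewrite big1 => [|i /negPf ni]; first by rewrite !addr0.
by apply: big1 => j _; rewrite dX eq_sym ni mul0r mulr0.
Qed.

Lemma biderivation_skew_biderivation :
  (forall a b, B a b = - B b a) -> skew_biderivation br.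
Proof.
move=> B_skew; split.
- move=> r c p q; rewrite scaler_sumr -big_split; apply: eq_bigr => a _ /=.
  rewrite scaler_sumr -big_split; apply: eq_bigr => b _ /=.
  by rewrite mderivD mderivZ -!mul_mpolyC; ring.
- move=> p q r; rewrite !mulr_sumr -big_split; apply: eq_bigr => a _ /=.
  rewrite !mulr_sumr -big_split; apply: eq_bigr => b _ /=.
  by rewrite mderivM; ring.
- move=> p q; rewrite /br exchange_big -sumrN; apply: eq_bigr => a _ /=.
  by rewrite -sumrN; apply: eq_bigr => b _; rewrite B_skew; ring.
Qed.

End Biderivation.

(** * The bracket of the theorem and its Jacobi identity on generators *)

Section Bracket.

Variables (k : fieldType) (char0 : [pchar k] =i pred0) (n : nat).
Variables (Gamma : 'M[k]_n) (P Q : 'rV[k]_n).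
Hypothesis Gamma_skew : forall i j, Gamma i j = - Gamma j i.

Local Notation y := (@yvar k n).
Local Notation x := (@xvar k n).

(** Merges the cases i < j and j < i: for all i <> j, {y_i, x_j} = -([pq_coef i j] + [Gamma i j])
    y_i x_j. *)
Definition pq_coef (i j : 'I_n) : k := if (i < j)%N then Q 0 i else P 0 i.

(** This is w_N; a natural number as bound allows induction on the number of terms. *)
Definition yx_sum (N : nat) : {mpoly k[n + n]} :=
  \sum_(l < n | (l < N)%N) (Q 0 l - P 0 l) *: (y l * x l).

Definition xy_bracket (i j : 'I_n) : {mpoly k[n + n]} :=
  if i == j then Q 0 i *: (y i * x i) + yx_sum i
  else (pq_coef j i + Gamma j i) *: (y j * x i).

Definition gen_bracket (a b : 'I_(n + n)) : {mpoly k[n + n]} :=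
  match split a, split b with
  | inl i, inl j => Gamma i j *: (y i * y j)
  | inr i, inl j => xy_bracket i j
  | inl i, inr j => - xy_bracket j i
  | inr i, inr j => (pq_coef i j - pq_coef j i + Gamma i j) *: (x i * x j)
  end.

Lemma gen_bracket_skew a b : gen_bracket a b = - gen_bracket b a.
Proof.
rewrite /gen_bracket.
case: (split a) (split b) => i [] j //; rewrite ?opprK // Gamma_skew;
  by rewrite -!mul_mpolyC; ring.
Qed.

Local Notation br := (biderivation gen_bracket).
Local Notation jac := (jacobiator br).

Lemma gen_bracket_bider : skew_biderivation br.
Proof. exact: biderivation_skew_biderivation gen_bracket_skew. Qed.

Let br_skew := skewbd_skew gen_bracket_bider.
Let br_Ml := skewbd_Ml gen_bracket_bider.
Let br_Dl := skewbd_Dl gen_bracket_bider.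
Let br_Zl := skewbd_Zl gen_bracket_bider.
Let br_diag := skewbd_alternating gen_bracket_bider char0.
Let jac_diag := jacobiator_diag gen_bracket_bider char0.

Lemma br_yy i j : br (y i) (y j) = Gamma i j *: (y i * y j).
Proof.
by rewrite biderivationX /gen_bracket !(unsplitK (inl _)).
Qed.

Lemma br_xy i j : br (x i) (y j) = xy_bracket i j.
Proof.
by rewrite biderivationX /gen_bracket (unsplitK (inl _)) (unsplitK (inr _)).
Qed.

Lemma br_xx i j :
  br (x i) (x j) = (pq_coef i j - pq_coef j i + Gamma i j) *: (x i * x j).
Proof.
by rewrite biderivationX /gen_bracket !(unsplitK (inr _)).
Qed.

Lemma br_xy_neq i j :
  i != j -> br (x i) (y j) = (pq_coef j i + Gamma j i) *: (x i * y j).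
Proof. by move=> /negPf ij; rewrite br_xy /xy_bracket ij (mulrC (y j)). Qed.

Lemma br_yx_neq i j :
  i != j -> br (y i) (x j) = - (pq_coef i j + Gamma i j) *: (y i * x j).
Proof. by move=> ij; rewrite br_skew br_xy_neq 1?eq_sym // scaleNr mulrC. Qed.

Lemma br_xy_diag i : br (x i) (y i) = Q 0 i *: (y i * x i) + yx_sum i.
Proof. by rewrite br_xy /xy_bracket eqxx. Qed.

Definition gen (s : bool) (i : 'I_n) := if s then x i else y i.

Lemma gen_surj (a : 'I_(n + n)) : exists s i, 'X_a = gen s i.
Proof.
by case: (split_ordP a) => i ->; [exists false, i | exists true, i].
Qed.

Lemma br_gen_neq s t i j : i != j ->
  exists c, br (gen s i) (gen t j) = c *: (gen s i * gen t j).
Proof.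
case: s t => [] [] /= ij; eexists.
- exact: br_xx.
- exact: br_xy_neq.
- exact: br_yx_neq.
- exact: br_yy.
Qed.

(** The entries of [Gamma] cancel in a + b. What remains depends on i only through its side of j, so
    all z_i with i on one side of j scale [gen s j] by the same factor. *)
Lemma br_x_y_gen s i j : i != j ->
  exists a b, [/\ br (x i) (gen s j) = a *: (x i * gen s j),
    br (y i) (gen s j) = b *: (y i * gen s j)
    & a + b = (-1) ^+ s * pq_coef j i].
Proof.
case: s => /= ij; do 2!eexists; split.
- exact: br_xx.
- exact: br_yx_neq.
- by ring.
- exact: br_xy_neq.
- exact: br_yy.
- by rewrite (Gamma_skew i); ring.
Qed.

Lemma br_yx_gen s i j : i != j ->
  br (y i * x i) (gen s j)
  = ((-1) ^+ s * pq_coef j i) *: (y i * x i * gen s j).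
Proof.
move=> /(br_x_y_gen s) [a [b [xg yg <-]]].
by rewrite br_Ml xg yg -!mul_mpolyC; ring.
Qed.

Lemma br_yx_gen_diag s i :
  br (y i * x i) (gen s i)
  = (-1) ^+ s *: ((Q 0 i *: (y i * x i) + yx_sum i) * gen s i).
Proof.
rewrite br_Ml.
case: s => /=; rewrite br_diag ?(br_skew (y i)) br_xy_diag -!mul_mpolyC;
  by ring.
Qed.

Lemma yx_sumS (i : 'I_n) :
  yx_sum i.+1 = yx_sum i + (Q 0 i - P 0 i) *: (y i * x i).
Proof.
rewrite /yx_sum (bigD1 i) //= addrC; congr (_ + _); apply: eq_bigl => l.
by rewrite ltnS ltn_neqAle andbC.
Qed.

(** Up to the sign (-1)^s, the factor is p_j until z_j enters the sum and q_j from then on. *)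
Lemma br_yx_sum_gen s (j : 'I_n) N : (N <= n)%N ->
  br (yx_sum N) (gen s j)
  = ((-1) ^+ s * (if (j < N)%N then Q 0 j else P 0 j))
    *: (yx_sum N * gen s j).
Proof.
elim: N => [_|N IHN ltNn].
  have -> : yx_sum 0 = 0 by apply: big_pred0.
  by rewrite (skewbd_0l gen_bracket_bider) mul0r scaler0.
rewrite (yx_sumS (Ordinal ltNn)) br_Dl br_Zl.
rewrite IHN ?(ltnW ltNn) //.
case: (eqVneq (Ordinal ltNn) j) => [<-|neq].
  (* The switch at N = j: p_j w_j + (q_j - p_j)(q_j z_j + w_j) = q_j (w_j + (q_j - p_j) z_j). *)
  by rewrite br_yx_gen_diag /= ltnn ltnSn -!mul_mpolyC; ring.
have -> : (j < N.+1)%N = (j < N)%N.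
  rewrite ltnS leq_eqVlt; case: eqP => [eqN|//].
  by case/eqP: neq; apply: val_inj.
(* For N <> j the new term z_N has the same factor as w_N. *)
by rewrite br_yx_gen // /pq_coef /=; case: ifP => _; rewrite -!mul_mpolyC; ring.
Qed.

Lemma jacobiator_x_y_gen s i j : i != j -> jac (x i) (y i) (gen s j) = 0.
Proof.
move=> ij; have [a [b [xg yg ab]]] := br_x_y_gen s ij.
apply: (jacobiator_semi_log_canonical gen_bracket_bider xg yg).
rewrite br_xy_diag br_Dl br_Zl br_yx_gen //.
(* At N = i the factor of w_i is that of z_i, namely a + b. *)
rewrite br_yx_sum_gen ?(ltnW (ltn_ord i)) // ab /pq_coef.
by rewrite -!mul_mpolyC; ring.
Qed.

Lemma jacobiator_gen_same s t u i l :
  jac (gen s i) (gen t i) (gen u l) = 0.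
Proof.
have [il|il] := eqVneq i l; last first.
  case: s t => [] [] /=; rewrite ?jac_diag ?jacobiator_x_y_gen //.
  by rewrite (jacobiator_swap gen_bracket_bider) jacobiator_x_y_gen ?oppr0.
(* Only x_i and y_i carry the index i, so two of the three arguments coincide; cycling makes them
   the first two. *)
rewrite -il; case: s t u => [] [] [];
  by rewrite ?jac_diag // jacobiator_cycle ?jac_diag //
    jacobiator_cycle jac_diag.
Qed.

Lemma jacobiator_gen a b c : jac 'X_a 'X_b 'X_c = 0.
Proof.
have [s [i ->]] := gen_surj a; have [t [j ->]] := gen_surj b.
have [u [l ->]] := gen_surj c.
have [<-|ij] := eqVneq i j; first exact: jacobiator_gen_same.
have [<-|jl] := eqVneq j l.
  by rewrite jacobiator_cycle jacobiator_gen_same.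
have [<-|li] := eqVneq l i.
  by rewrite 2!jacobiator_cycle jacobiator_gen_same.
have [d st] := br_gen_neq s t ij; have [e tu] := br_gen_neq t u jl.
have [f us] := br_gen_neq u s li.
exact: (jacobiator_log_canonical gen_bracket_bider st tu us).
Qed.

End Bracket.

Theorem theorem2p1 (k : closedFieldType) (char0 : [pchar k] =i pred0)
    (n : nat) (Gamma : 'M[k]_n) (P Q : 'rV[k]_n)
    (Gamma_skew : forall i j : 'I_n, Gamma i j = - Gamma j i)
    (PQ_neq : forall i : 'I_n, P 0 i <> Q 0 i) :
  let y : 'I_n -> {mpoly k[n + n]} := @yvar k n in
  let x : 'I_n -> {mpoly k[n + n]} := @xvar k n in
  exists br : {mpoly k[n + n]} -> {mpoly k[n + n]} -> {mpoly k[n + n]},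
    is_poisson_bracket br /\
    (forall i j : 'I_n, br (y i) (y j) = Gamma i j *: (y i * y j)) /\
    (forall i j : 'I_n, (i < j)%N ->
       br (x i) (y j) = (P 0 j - Gamma i j) *: (y j * x i)) /\
    (forall i j : 'I_n, (i < j)%N ->
       br (y i) (x j) = - (Q 0 i + Gamma i j) *: (y i * x j)) /\
    (forall i j : 'I_n, (i < j)%N ->
       br (x i) (x j) = (Q 0 i - P 0 j + Gamma i j) *: (x i * x j)) /\
    (forall i : 'I_n,
       br (x i) (y i) = Q 0 i *: (y i * x i)
         + \sum_(l < n | (l < i)%N) (Q 0 l - P 0 l) *: (y l * x l)).
Proof.
move=> y x; exists (biderivation (gen_bracket Gamma P Q)).
split; first exact: skewbd_poisson (gen_bracket_bider P Q Gamma_skew)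
  char0 (jacobiator_gen char0 P Q Gamma_skew).
split; first exact: br_yy.
split=> [i j ij|]; first rewrite (mulrC (y j)) br_xy_neq ?/pq_coef.
(* As j < i fails, [pq_coef j i] is p_j, and skewness turns [Gamma j i] into [- Gamma i j]. *)
- by rewrite ltnNge (ltnW ij) (Gamma_skew j).
- by rewrite neq_ltn ij.
split=> [i j ij|].
  by rewrite br_yx_neq // /pq_coef ?ij // neq_ltn ij.
split=> [i j ij|]; last exact: br_xy_diag.
by rewrite br_xx /pq_coef ij ltnNge (ltnW ij).
Qed.
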